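(* Let $L$ be a finitely algebraizable logic in the language $\tau$ with equivalent algebraic semantics $\mathcal{Q}$. Let $\Sigma$ and $\Sigma'$ be two sets of EFD-sentences in $\tau$. 1. The following are equivalent: (i) there is a $\tau$-morphism from $L^{\Sigma'}$ to $L^\Sigma$; (ii) there is a $\tau$-interpretation of $\mathcal{Q}^{\Sigma'}$ in $\mathcal{Q}^\Sigma$; (iii) $\mathcal{Q} \cap \mathrm{Mod}(\Sigma) \subseteq \mathcal{Q} \cap \mathrm{Mod}(\Sigma')$. 2. The following are equivalent: (i) $L^{\Sigma'}$ and $L^\Sigma$ are $\tau$-equipollent; (ii) $\mathcal{Q}^{\Sigma'}$ and $\mathcal{Q}^\Sigma$ are $\tau$-term-equivalent; (iii) $\mathcal{Q} \cap \mathrm{Mod}(\Sigma) = \mathcal{Q} \cap \mathrm{Mod}(\Sigma')$.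
   Context: An EFD-sentence in a language $\tau$ is a sentence $\varphi = \forall x_1\ldots x_n \exists! z_1\ldots z_m \bigwedge_{i=1}^k s_i(\bar x,\bar z)=t_i(\bar x,\bar z)$ with $s_i,t_i$ $\tau$-terms, $n\ge 0$, $m\ge1$; $U(\varphi)$ denotes the (quasi-identity) uniqueness part $\forall \bar x\bar y\bar z\,(\alpha(\bar x,\bar y)\wedge\alpha(\bar x,\bar z)\to \bar y=\bar z)$. For a quasivariety $\mathcal{Q}$ axiomatized by quasi-identities $\Gamma$ and a set $\Sigma$ of EFD-sentences, $\mathcal{Q}^\Sigma := \mathrm{Mod}(\Gamma\cup E_\Sigma\cup U_\Sigma)$ in the language $\tau_\Sigma$ obtained by adding, for each $\varphi\in\Sigma$, new $n$-ary symbols $f^\varphi_1,\dots,f^\varphi_m$, where $E_\Sigma$ consists of the identities $\forall\bar x\, s_i(\bar x,f^\varphi_1(\bar x),\dots,f^\varphi_m(\bar x))=t_i(\bar x,f^\varphi_1(\bar x),\dots,f^\varphi_m(\bar x))$ and $U_\Sigma=\{U(\varphi):\varphi\in\Sigma\}$. Logics are finitary structural consequence operators. If $L$ is algebraizable with equivalence formulas $\Delta(x,y)$ and $\Phi(\bar x,\bar z)$ is a finite set of formulas, $L^\Phi$ is the least logic containing $L$ with new $n$-ary symbols $f^\Phi_1,\dots,f^\Phi_m$ such that $\vdash \Phi(\bar x,f^\Phi_1(\bar x),\dots,f^\Phi_m(\bar x))$ and $\Phi(\bar x,\bar y),\Phi(\bar x,\bar z)\vdash \bigcup_j\Delta(y_j,z_j)$;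 $L^\Sigma$ for a set $\Sigma$ of EFD-sentences means the least logic containing $L^{\Phi}$ for each $\Phi = \bigcup_i \Delta(s_i,t_i)$ with $\forall\bar x\exists!\bar z\bigwedge_i s_i=t_i\in\Sigma$. For expansions $\tau_1,\tau_2$ of $\tau$, a $\tau$-translation is a map $T$ sending each $n$-ary symbol of $\tau_1$ to a $\tau_2$-term in $x_1,\dots,x_n$ with $T(f)=f(x_1,\dots,x_n)$ for $f\in\tau$ (extended to all terms). A $\tau$-interpretation of a class $\mathcal{K}_1$ in $\mathcal{K}_2$ is a $\tau$-translation $T$ with $\mathbf{A}^T:=(A,\{T(f)^{\mathbf{A}}:f\in\tau_1\})\in\mathcal{K}_1$ for all $\mathbf{A}\in\mathcal{K}_2$; $\mathcal{K}_1,\mathcal{K}_2$ are $\tau$-term-equivalent if there are mutually inverse such interpretations. A $\tau$-morphism from $L_1$ to $L_2$ is a $\tau$-translation $T$ with $\Gamma\vdash_{L_1}\varphi$ implying $T(\Gamma)\vdash_{L_2}T(\varphi)$; $L_1,L_2$ are $\tau$-equipollent if there are $\tau$-morphisms $T$, $S$ both ways with $\varphi\dashv\vdash_{L_1}S(T(\varphi))$ and $\varphi\dashv\vdash_{L_2}T(S(\varphi))$ for all formulas.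
   Formalization: (iii)⇒(i),(ii) is stated under the proviso that if τ_Σ' has a constant symbol so does τ_Σ (in part 2: iff); without it the claim fails, e.g. implication algebras, Σ empty, Σ'={∃!z (z→z=z)}: no closed term to translate to. (i) and (ii) each imply the proviso. *)

(* Defs.v *)
From mathcomp Require Import all_boot.
From Stdlib Require List.

Set Implicit Arguments.
Unset Strict Implicit.
Unset Printing Implicit Defensive.

(** * Languages, terms, algebras *)

Record signature : Type := Signature { sym : Type; arity : sym -> nat }.

(* The expansion of [tau] by the new symbols of [nu]. *)
Definition expand (tau nu : signature) : signature :=
  @Signature (sym tau + sym nu)
    (fun f => match f with inl g => arity g | inr g => arity g end).

(* Efd-sentences with n = 0 add constants. A nullary symbol can only be
   translated by a closed term, so no translation exists from a language with
   constants to one without. *)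
Definition has_constant (tau : signature) : Prop :=
  exists c : sym tau, arity c = 0.

(* Terms with variables in [V]: a term in x_1, ..., x_n has type
   [term tau 'I_n]; formulas of a logic have countably many variables. *)
Inductive term (tau : signature) (V : Type) : Type :=
| Var (v : V)
| App (f : sym tau) (args : 'I_(arity f) -> term tau V).

Arguments Var {tau V} v.
Arguments App {tau V} f args.

Definition formula (tau : signature) : Type := term tau nat.

Fixpoint subst tau (V W : Type) (s : V -> term tau W) (t : term tau V) :
    term tau W :=
  match t with
  | Var v => s v
  | App f args => App f (fun i => subst s (args i))
  end.

Definition equation (tau : signature) (V : Type) : Type :=
  (term tau V * term tau V)%type.

Definition subst_eq tau (V W : Type) (s : V -> term tau W)
    (e : equation tau V) : equation tau W :=
  (subst s e.1, subst s e.2).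

Record algebra (tau : signature) : Type := Algebra {
  carrier :> Type;
  carrier_nonempty : inhabited carrier;
  op : forall f : sym tau, ('I_(arity f) -> carrier) -> carrier }.

Fixpoint eval tau (A : algebra tau) (V : Type) (rho : V -> A)
    (t : term tau V) : A :=
  match t with
  | Var v => rho v
  | App f args => op (fun i => eval rho (args i))
  end.

Definition holds tau (A : algebra tau) (V : Type) (rho : V -> A)
    (e : equation tau V) : Prop :=
  eval rho e.1 = eval rho e.2.

(** * Translations of terms *)

Definition translation (tau1 tau2 : signature) : Type :=
  forall f : sym tau1, term tau2 'I_(arity f).

Fixpoint translate tau1 tau2 (T : translation tau1 tau2) (V : Type)
    (t : term tau1 V) : term tau2 V :=
  match t with
  | Var v => Var v
  | App f args => subst (fun i => translate T (args i)) (T f)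
  end.

Definition translate_eq tau1 tau2 (T : translation tau1 tau2) (V : Type)
    (e : equation tau1 V) : equation tau2 V :=
  (translate T e.1, translate T e.2).

(* The algebra A^T. *)
Definition pull tau1 tau2 (T : translation tau1 tau2) (A : algebra tau2) :
    algebra tau1 :=
  @Algebra tau1 A (carrier_nonempty A) (fun f args => eval args (T f)).

Definition inclusion (tau nu : signature) : translation tau (expand tau nu) :=
  fun f => @App (expand tau nu) _ (inl f) Var.

Definition tau_translation (tau nu1 nu2 : signature)
    (T : translation (expand tau nu1) (expand tau nu2)) : Prop :=
  forall f : sym tau, T (inl f) = @App (expand tau nu2) _ (inl f) Var.

(** * Quasivarieties *)

Record quasi_identity (tau : signature) : Type := QuasiIdentity {
  premises : seq (equation tau nat);
  conclusion : equation tau nat }.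

Definition translate_qi tau1 tau2 (T : translation tau1 tau2)
    (q : quasi_identity tau1) : quasi_identity tau2 :=
  QuasiIdentity (map (translate_eq T (V:=nat)) (premises q))
    (translate_eq T (conclusion q)).

Definition satisfies_qi tau (A : algebra tau) (q : quasi_identity tau) : Prop :=
  forall rho : nat -> A,
    (forall e, List.In e (premises q) -> holds rho e) ->
    holds rho (conclusion q).

Definition Mod tau (G : quasi_identity tau -> Prop) (A : algebra tau) : Prop :=
  forall q, G q -> satisfies_qi A q.

(* Equational consequence relative to a class of algebras. *)
Definition eq_conseq tau (K : algebra tau -> Prop)
    (Th : equation tau nat -> Prop) (e : equation tau nat) : Prop :=
  forall A, K A -> forall rho : nat -> A,
    (forall e', Th e' -> holds rho e') -> holds rho e.

(** * Logics *)

Definition entailment (tau : signature) : Type :=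
  (formula tau -> Prop) -> formula tau -> Prop.

Definition image (X Y : Type) (g : X -> Y) (P : X -> Prop) (y : Y) : Prop :=
  exists2 x, P x & y = g x.

Record is_logic tau (L : entailment tau) : Prop := IsLogic {
  logic_refl : forall (Gam : formula tau -> Prop) phi, Gam phi -> L Gam phi;
  logic_mono : forall (Gam Gam' : formula tau -> Prop) phi,
    (forall psi, Gam psi -> Gam' psi) -> L Gam phi -> L Gam' phi;
  logic_cut : forall (Gam Gam' : formula tau -> Prop) phi,
    (forall psi, Gam' psi -> L Gam psi) -> L Gam' phi -> L Gam phi;
  logic_structural : forall (s : nat -> formula tau) Gam phi,
    L Gam phi -> L (image (subst s) Gam) (subst s phi);
  logic_finitary : forall Gam phi, L Gam phi ->
    exists l : seq (formula tau),
      (forall psi, List.In psi l -> Gam psi) /\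
      L (fun psi => List.In psi l) phi }.

Definition preserves tau1 tau2 (T : translation tau1 tau2)
    (L1 : entailment tau1) (L2 : entailment tau2) : Prop :=
  forall Gam phi, L1 Gam phi -> L2 (image (translate T (V:=nat)) Gam) (translate T phi).

(* The intersection of all logics satisfying [P]; for the two conditions used
   below it is again a finitary structural logic satisfying [P], hence the
   least one (see [logic_by_formulas_least] and [logic_by_efds_least]). *)
Definition least_logic tau (P : entailment tau -> Prop) : entailment tau :=
  fun Gam phi => forall L, is_logic L -> P L -> L Gam phi.

Definition is_least_logic tau (P : entailment tau -> Prop)
    (L : entailment tau) : Prop :=
  [/\ is_logic L, P L & forall L', is_logic L' -> P L' ->
      forall Gam phi, L Gam phi -> L' Gam phi].

(** * Algebraizability *)

(* In a set of equivalence formulas Delta(x, y) the variable x is [false] and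
   y is [true]. *)
Definition equiv_at tau (V : Type) (s t : term tau V) (d : term tau bool) :
    term tau V :=
  subst (fun b : bool => if b then t else s) d.

(* Instance at a formula of a defining equation in one variable. *)
Definition defeq_at tau (V : Type) (t : term tau V) (e : equation tau unit) :
    equation tau V :=
  subst_eq (fun _ => t) e.

(* [L] is finitely algebraizable with equivalent algebraic semantics [K],
   defining equations [E] and finite set of equivalence formulas [Delta]. *)
Record finitely_algebraizable tau (L : entailment tau)
    (K : algebra tau -> Prop) (E : equation tau unit -> Prop)
    (Delta : seq (term tau bool)) : Prop := FinitelyAlgebraizable {
  alg_complete : forall Gam phi,
    L Gam phi <->
    (forall e, E e ->
       eq_conseq K
         (fun e' => exists psi, exists2 d, E d & Gam psi /\ e' = defeq_at psi d)
         (defeq_at phi e));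
  alg_equiv_elim :
    eq_conseq K
      (fun e' => exists d, exists2 e, E e & List.In d Delta /\
         e' = defeq_at (equiv_at (Var 0) (Var 1) d) e)
      (Var 0, Var 1);
  alg_equiv_intro : forall d e, List.In d Delta -> E e ->
    eq_conseq K (fun e' => e' = (Var 0, Var 1))
      (defeq_at (equiv_at (Var 0) (Var 1) d) e) }.

(** * EFD-sentences *)

(* forall x_1..x_n exists! z_1..z_m, /\_i s_i(x, z) = t_i(x, z); [inl i] is the
   variable x_i and [inr j] the variable z_j. *)
Record efd (tau : signature) : Type := EFD {
  efd_n : nat;
  efd_m : nat;
  efd_m_gt0 : 0 < efd_m;
  efd_eqs : seq (equation tau ('I_efd_n + 'I_efd_m)) }.

Definition valuation (X V W : Type) (a : V -> X) (b : W -> X) (v : V + W) : X :=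
  match v with inl i => a i | inr j => b j end.

Definition satisfies_efd tau (A : algebra tau) (p : efd tau) : Prop :=
  forall a : 'I_(efd_n p) -> A,
    exists! b : 'I_(efd_m p) -> A,
      forall e, List.In e (efd_eqs p) -> holds (valuation a b) e.

Definition Mod_efd tau (Sig : efd tau -> Prop) (A : algebra tau) : Prop :=
  forall p, Sig p -> satisfies_efd A p.

(* Pairwise distinct variables among those of formulas for the blocks
   x_1..x_n, y_1..y_m, z_1..z_m. *)
Definition xvar tau (n : nat) (i : 'I_n) : formula tau := Var (i : nat).
Definition yvar tau (n m : nat) (j : 'I_m) : formula tau := Var (n + j).
Definition zvar tau (n m : nat) (j : 'I_m) : formula tau := Var (n + m + j).

Arguments xvar {tau n} i.
Arguments yvar {tau} n {m} j.
Arguments zvar {tau} n {m} j.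

(* The substitutions taking (x, z) to (x, y) and to (x, z). *)
Definition to_xy tau (n m : nat) : 'I_n + 'I_m -> formula tau :=
  valuation xvar (yvar n).
Definition to_xz tau (n m : nat) : 'I_n + 'I_m -> formula tau :=
  valuation xvar (zvar n).

(* tau_Sigma is [expand tau (skolem_sig Sig)]. *)
Definition skolem_sig tau (Sig : efd tau -> Prop) : signature :=
  @Signature {p : {p : efd tau | Sig p} & 'I_(efd_m (sval p))}
    (fun f => efd_n (sval (projT1 f))).

Definition efd_lang tau (Sig : efd tau -> Prop) : signature :=
  expand tau (skolem_sig Sig).

(* The substitution taking (x, z) to (x, f_1(x), ..., f_m(x)). *)
Definition to_skolem tau (Sig : efd tau -> Prop) (p : efd tau) (hp : Sig p)
    (v : 'I_(efd_n p) + 'I_(efd_m p)) : formula (efd_lang Sig) :=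
  valuation xvar
    (fun j => @App (efd_lang Sig) nat (inr (existT _ (exist _ p hp) j)) xvar) v.

Definition E_set tau (Sig : efd tau -> Prop) (q : quasi_identity (efd_lang Sig)) :
    Prop :=
  exists p, exists hp : Sig p, exists2 e, List.In e (efd_eqs p) &
    q = QuasiIdentity [::]
          (subst_eq (to_skolem hp) (translate_eq (@inclusion tau _) e)).

(* U(p) has m equations in its conclusion; it is represented by the m
   quasi-identities with the same premises and one of these conclusions. *)
Definition uniqueness tau (p : efd tau) (j : 'I_(efd_m p)) : quasi_identity tau :=
  QuasiIdentity
    (map (subst_eq (@to_xy tau (efd_n p) (efd_m p))) (efd_eqs p) ++
     map (subst_eq (@to_xz tau (efd_n p) (efd_m p))) (efd_eqs p))
    (yvar (efd_n p) j, zvar (efd_n p) j).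

Definition U_set tau (Sig : efd tau -> Prop) (q : quasi_identity tau) : Prop :=
  exists p, exists j : 'I_(efd_m p), Sig p /\ q = uniqueness j.

(* Q^Sigma for Q = Mod G. *)
Definition quasivariety_by_efds tau (G : quasi_identity tau -> Prop)
    (Sig : efd tau -> Prop) : algebra (efd_lang Sig) -> Prop :=
  Mod (fun q =>
    [\/ image (translate_qi (@inclusion tau _)) G q,
        E_set q
      | image (translate_qi (@inclusion tau _)) (U_set Sig) q]).

Arguments quasivariety_by_efds {tau} G Sig _.

(** * Algebraic expansions of a logic *)

Definition formula_lang (tau : signature) (n m : nat) : signature :=
  expand tau (@Signature 'I_m (fun _ => n)).

Definition to_new_symbols tau (n m : nat) (v : 'I_n + 'I_m) :
    formula (formula_lang tau n m) :=
  valuation xvar (fun j => @App (formula_lang tau n m) nat (inr j) xvar) v.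

Record realizes_formulas tau (L : entailment tau) (Delta : seq (term tau bool))
    (n m : nat) (Phi : seq (term tau ('I_n + 'I_m)))
    (L' : entailment (formula_lang tau n m)) : Prop := RealizesFormulas {
  rf_contains : preserves (@inclusion tau _) L L';
  rf_existence : forall phi, List.In phi Phi ->
    L' (fun _ => False)
      (subst (@to_new_symbols tau n m) (translate (@inclusion tau _) phi));
  rf_uniqueness : forall (j : 'I_m) d, List.In d Delta ->
    L' (image (translate (@inclusion tau _) (V:=nat))
          (fun psi => List.In psi
             (map (subst (@to_xy tau n m)) Phi ++
              map (subst (@to_xz tau n m)) Phi)))
       (translate (@inclusion tau _) (equiv_at (yvar n j) (zvar n j) d)) }.

(* L^Phi *)
Definition logic_by_formulas tau (L : entailment tau)
    (Delta : seq (term tau bool)) (n m : nat)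
    (Phi : seq (term tau ('I_n + 'I_m))) : entailment (formula_lang tau n m) :=
  least_logic (realizes_formulas L Delta Phi).

Definition efd_formulas tau (Delta : seq (term tau bool)) (p : efd tau) :
    seq (term tau ('I_(efd_n p) + 'I_(efd_m p))) :=
  flatten [seq map (equiv_at e.1 e.2) Delta | e <- efd_eqs p].

(* The inclusion of the language of L^Phi into tau_Sigma for Phi coming from
   [p] in Sigma. *)
Definition efd_inclusion tau (Sig : efd tau -> Prop) (p : efd tau) (hp : Sig p) :
    translation (formula_lang tau (efd_n p) (efd_m p)) (efd_lang Sig) :=
  fun f => match f with
    | inl g => @App (efd_lang Sig) _ (inl g) Var
    | inr j => @App (efd_lang Sig) _ (inr (existT _ (exist _ p hp) j)) Var
    end.

(* Containment of [L] itself matters only when Sigma is empty. *)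
Record realizes_efds tau (L : entailment tau) (Delta : seq (term tau bool))
    (Sig : efd tau -> Prop) (L' : entailment (efd_lang Sig)) : Prop :=
  RealizesEFDs {
  re_contains : preserves (@inclusion tau _) L L';
  re_contains_each : forall p (hp : Sig p),
    preserves (efd_inclusion hp)
      (logic_by_formulas L Delta (efd_formulas Delta p)) L' }.

(* L^Sigma *)
Definition logic_by_efds tau (L : entailment tau) (Delta : seq (term tau bool))
    (Sig : efd tau -> Prop) : entailment (efd_lang Sig) :=
  least_logic (@realizes_efds tau L Delta Sig).

Arguments realizes_efds {tau} L Delta Sig _.
Arguments logic_by_efds {tau} L Delta Sig _ _.

(** * Morphisms, interpretations and equivalences *)

Section Comparison.
Variables (tau nu1 nu2 : signature).
Implicit Types (T : translation (expand tau nu1) (expand tau nu2))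
               (S : translation (expand tau nu2) (expand tau nu1)).

Definition tau_morphism (L1 : entailment (expand tau nu1))
    (L2 : entailment (expand tau nu2)) T : Prop :=
  tau_translation T /\ preserves T L1 L2.

(* [T] is a tau-interpretation of [K1] in [K2]. *)
Definition tau_interpretation (K1 : algebra (expand tau nu1) -> Prop)
    (K2 : algebra (expand tau nu2) -> Prop) T : Prop :=
  tau_translation T /\ forall A, K2 A -> K1 (pull T A).
End Comparison.

Definition interderivable tau (L : entailment tau) (phi psi : formula tau) : Prop :=
  L (fun chi => chi = phi) psi /\ L (fun chi => chi = psi) phi.

Definition tau_equipollent (tau nu1 nu2 : signature)
    (L1 : entailment (expand tau nu1)) (L2 : entailment (expand tau nu2)) : Prop :=
  exists T S, [/\ tau_morphism L1 L2 T, tau_morphism L2 L1 S,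
    forall phi, interderivable L1 phi (translate S (translate T phi)) &
    forall phi, interderivable L2 phi (translate T (translate S phi))].

Definition tau_term_equivalent (tau nu1 nu2 : signature)
    (K1 : algebra (expand tau nu1) -> Prop)
    (K2 : algebra (expand tau nu2) -> Prop) : Prop :=
  exists T S, [/\ tau_interpretation K1 K2 T, tau_interpretation K2 K1 S,
    forall A, K1 A -> pull T (pull S A) = A &
    forall A, K2 A -> pull S (pull T A) = A].

(** * The logics L^Phi and L^Sigma are least logics *)

Section LeastLogic.
Variables (tau : signature) (P : entailment tau -> Prop).

Definition finitary_part (L : entailment tau) : entailment tau :=
  fun Gam phi => exists l : seq (formula tau),
    (forall psi, List.In psi l -> Gam psi) /\ L (fun psi => List.In psi l) phi.

Lemma finitary_part_least_logic_is_logic :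
  is_logic (finitary_part (least_logic P)).
Proof.
split.
- move=> Gam phi h; exists [:: phi]; split=> [psi [<-|[]] //|].
  by move=> L hL _; apply: (logic_refl hL); left.
- move=> Gam Gam' phi sub [l [lG h]].
  by exists l; split=> // psi /lG /sub.
- move=> Gam Gam' phi hG [l [lG h]].
  have [k [kG hk]] : exists k : seq (formula tau),
      (forall psi, List.In psi k -> Gam psi) /\
      (forall psi, List.In psi l -> least_logic P (fun chi => List.In chi k) psi).
    elim: l lG {h} => [|chi l IH] lG; first by exists [::].
    have [k [kG hk]] := IH (fun psi h => lG psi (or_intror h)).
    have [k' [k'G hk']] := hG chi (lG chi (or_introl erefl)).
    exists (k' ++ k); split=> [psi /List.in_app_iff[/k'G|/kG] //|psi].
    case=> [<-|/hk h] L hL PL; [have := hk' L hL PL | have := h L hL PL];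
      apply: (logic_mono hL) => x hx; apply/List.in_app_iff; by [left | right].
  exists k; split=> // L hL PL.
  by apply: (logic_cut hL _ (h L hL PL)) => psi /hk; apply.
- move=> s Gam phi [l [lG h]]; exists (map (subst s) l); split.
    by move=> _ /List.in_map_iff[psi [<- /lG hp]]; exists psi.
  move=> L hL PL; apply: (logic_mono hL _ (logic_structural hL s (h L hL PL))).
  by move=> _ [psi hp ->]; apply: List.in_map.
- move=> Gam phi [l [lG h]]; exists l; split=> //.
  by exists l; split.
Qed.

Lemma least_logic_is_least :
  P (finitary_part (least_logic P)) -> P (least_logic P) ->
  is_least_logic P (least_logic P).
Proof.
move=> Pfin Pleast; split=> //; last by move=> L hL PL Gam phi; apply.
split.
- by move=> Gam phi h L hL _; apply: (logic_refl hL).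
- by move=> Gam Gam' phi sub h L hL PL; apply: (logic_mono hL sub (h L hL PL)).
- move=> Gam Gam' phi hG h L hL PL.
  by apply: (logic_cut hL _ (h L hL PL)) => psi /hG; apply.
- by move=> s Gam phi h L hL PL; apply: (logic_structural hL s (h L hL PL)).
- move=> Gam phi h.
  exact: (h _ finitary_part_least_logic_is_logic Pfin).
Qed.

Lemma least_logic_mono (Gam Gam' : formula tau -> Prop) phi :
  (forall psi, Gam psi -> Gam' psi) ->
  least_logic P Gam phi -> least_logic P Gam' phi.
Proof. by move=> sub h L hL PL; apply: (logic_mono hL sub (h L hL PL)). Qed.

Lemma finitary_part_preserves tau0 (T : translation tau0 tau)
    (L0 : entailment tau0) :
  is_logic L0 -> preserves T L0 (least_logic P) ->
  preserves T L0 (finitary_part (least_logic P)).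
Proof.
move=> hL0 hT Gam phi /(logic_finitary hL0)[l [lG h]].
exists (map (translate T (V:=nat)) l); split.
  by move=> _ /List.in_map_iff[psi [<- /lG hp]]; exists psi.
apply: least_logic_mono (hT _ _ h) => _ [psi hp ->].
exact: List.in_map.
Qed.

End LeastLogic.

Lemma logic_by_formulas_least tau (L : entailment tau)
    (Delta : seq (term tau bool)) (n m : nat)
    (Phi : seq (term tau ('I_n + 'I_m))) :
  is_logic L ->
  is_least_logic (realizes_formulas L Delta Phi) (logic_by_formulas L Delta Phi).
Proof.
move=> hL; have Pleast :
    realizes_formulas L Delta Phi (logic_by_formulas L Delta Phi).
  split.
  - by move=> Gam phi h L' _ hP; apply: (rf_contains hP).
  - by move=> phi h L' _ hP; apply: (rf_existence hP).
  - by move=> j d h L' _ hP; apply: (rf_uniqueness hP).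
apply: least_logic_is_least => //; split.
- exact: (finitary_part_preserves hL (rf_contains Pleast)).
- by move=> phi /(rf_existence Pleast) h; exists [::]; split.
- move=> j d /(rf_uniqueness Pleast j) h.
  exists (map (translate (@inclusion tau _) (V:=nat))
    (map (subst (@to_xy tau n m)) Phi ++ map (subst (@to_xz tau n m)) Phi)).
  split; first by move=> _ /List.in_map_iff[psi [<- hp]]; exists psi.
  by apply: least_logic_mono h => _ [psi hp ->]; apply: List.in_map.
Qed.

Lemma logic_by_efds_least tau (L : entailment tau)
    (Delta : seq (term tau bool)) (Sig : efd tau -> Prop) :
  is_logic L ->
  is_least_logic (realizes_efds L Delta Sig) (logic_by_efds L Delta Sig).
Proof.
move=> hL; have Pleast :
    realizes_efds L Delta Sig (logic_by_efds L Delta Sig).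
  split.
  - by move=> Gam phi h L' _ hP; apply: (re_contains hP).
  - by move=> p hp Gam phi h L' _ hP; apply: (re_contains_each hP).
apply: least_logic_is_least => //; split.
  exact: (finitary_part_preserves hL (re_contains Pleast)).
move=> p hp; apply: finitary_part_preserves (re_contains_each Pleast hp).
by have [] := logic_by_formulas_least Delta (efd_formulas Delta p) hL.
Qed.

(* Main.v *)
(* The quasivariety Q^Sigma is the equivalent algebraic semantics of L^Sigma.
   Soundness holds because the finitary part of the semantic consequence of
   Q^Sigma is a logic with the defining properties of L^Sigma. Completeness
   holds because the relation "Delta(s, t) is derivable" is a congruence (for a
   new symbol f, both f(a) and f(b) solve the system at a when a and b are
   equivalent, and solutions are unique) whose quotient lies in Q^Sigma.
   Morphisms of the logics thus correspond to interpretations of the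
   quasivarieties. Every member of Q satisfying Sigma has a unique expansion in
   Q^Sigma, so interpretations give inclusions of the classes of models and
   interpretations in both directions are mutually inverse. Conversely, if the
   models of Sigma satisfy Sigma', the solutions of a sentence of Sigma' at the
   generators of a free algebra of Q^Sigma are values of terms, and these terms
   define an interpretation. *)

From mathcomp Require Import all_boot.
From Stdlib Require List.
From Stdlib Require Import FunctionalExtensionality PropExtensionality.
From Stdlib Require Import ProofIrrelevance ClassicalEpsilon.
Require Import Defs.

Set Implicit Arguments.
Unset Strict Implicit.
Unset Printing Implicit Defensive.

(** * Substitution, evaluation and translation of terms *)

Lemma eval_subst tau (A : algebra tau) (V W : Type) (rho : W -> A)
    (s : V -> term tau W) (t : term tau V) :
  eval rho (subst s t) = eval (fun v => eval rho (s v)) t.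
Proof.
elim: t => [//|f args IH] /=; congr op.
by apply: functional_extensionality => i; apply: IH.
Qed.

Lemma subst_subst tau (U V W : Type) (s : V -> term tau W)
    (r : U -> term tau V) (t : term tau U) :
  subst s (subst r t) = subst (fun u => subst s (r u)) t.
Proof.
elim: t => [//|f args IH] /=; congr App.
by apply: functional_extensionality => i; apply: IH.
Qed.

Lemma eval_translate tau1 tau2 (T : translation tau1 tau2) (A : algebra tau2)
    (V : Type) (rho : V -> A) (t : term tau1 V) :
  eval rho (translate T t) = @eval _ (pull T A) V rho t.
Proof.
elim: t => [//|f args IH] /=; rewrite eval_subst; congr eval.
by apply: functional_extensionality => i; apply: IH.
Qed.

Lemma translate_subst tau1 tau2 (T : translation tau1 tau2) (V W : Type)
    (s : V -> term tau1 W) (t : term tau1 V) :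
  translate T (subst s t) = subst (fun v => translate T (s v)) (translate T t).
Proof.
elim: t => [//|f args IH] /=; rewrite subst_subst; congr subst.
by apply: functional_extensionality => i; apply: IH.
Qed.

(** A tau-translation fixes the symbols of tau. This also covers [efd_inclusion], whose source is
    the language of a single L^Phi. *)
Lemma translate_inclusion tau nu1 nu2
    (T : translation (expand tau nu1) (expand tau nu2)) (V : Type)
    (t : term tau V) :
  tau_translation T ->
  translate T (translate (@inclusion tau nu1) t)
    = translate (@inclusion tau nu2) t.
Proof.
move=> hT; elim: t => [//|f args IH] /=; rewrite hT /=; congr App.
by apply: functional_extensionality => i; apply: IH.
Qed.

Lemma translate_equiv_at tau1 tau2 (T : translation tau1 tau2) (V : Type)
    (s t : term tau1 V) d :
  translate T (equiv_at s t d)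
    = equiv_at (translate T s) (translate T t) (translate T d).
Proof.
rewrite /equiv_at translate_subst; congr subst.
by apply: functional_extensionality; case.
Qed.

Lemma subst_equiv_at tau (V W : Type) (r : V -> term tau W)
    (s t : term tau V) d :
  subst r (equiv_at s t d) = equiv_at (subst r s) (subst r t) d.
Proof.
rewrite /equiv_at subst_subst; congr subst.
by apply: functional_extensionality; case.
Qed.

(** * Algebras and quotients of term algebras *)

Notation reduct := (pull (@inclusion _ _)).

Lemma algebra_ext tau (c : Type) (ne : inhabited c)
    (o1 o2 : forall f : sym tau, ('I_(arity f) -> c) -> c) :
  (forall f args, o1 f args = o2 f args) -> Algebra ne o1 = Algebra ne o2.
Proof.
move=> h; congr Algebra; apply: functional_extensionality_dep => f.
by apply: functional_extensionality => args.
Qed.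

(** Equality of the records only relates the operations after transport along an equality of
    carriers. By proof irrelevance that equality is [erefl], and the transport disappears. *)
Lemma algebra_inj tau (c : Type) (ne : inhabited c)
    (o1 o2 : forall f : sym tau, ('I_(arity f) -> c) -> c) :
  Algebra ne o1 = Algebra ne o2 -> o1 = o2.
Proof.
move=> h.
have: eq_rect c (fun x => forall f : sym tau, ('I_(arity f) -> x) -> x) o1 c
        (f_equal (@carrier tau) h) = o2.
  exact: (match h as h0 in _ = B return
    eq_rect c (fun x => forall f : sym tau, ('I_(arity f) -> x) -> x) o1 (carrier B)
        (f_equal (@carrier tau) h0) = @op tau B with erefl => erefl end).
by rewrite (proof_irrelevance _ (f_equal (@carrier tau) h) erefl).
Qed.

Lemma reduct_pull tau nu1 nu2
    (T : translation (expand tau nu1) (expand tau nu2))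
    (A : algebra (expand tau nu2)) :
  tau_translation T -> reduct (pull T A) = reduct A :> algebra tau.
Proof. by move=> hT; apply: algebra_ext => f args /=; rewrite hT. Qed.

Definition satisfies_eqs tau (A : algebra tau) (p : efd tau)
    (a : 'I_(efd_n p) -> A) (b : 'I_(efd_m p) -> A) : Prop :=
  forall e, List.In e (efd_eqs p) -> holds (valuation a b) e.

(** The semantic content of U(p), with tuples in place of numbered variables. *)
Definition has_unique_solutions tau (A : algebra tau) (p : efd tau) : Prop :=
  forall (a : 'I_(efd_n p) -> A) b c,
    satisfies_eqs a b -> satisfies_eqs a c -> b = c.

Definition skolem tau (Sig : efd tau -> Prop) p (hp : Sig p)
    (j : 'I_(efd_m p)) : sym (efd_lang Sig) :=
  inr (existT _ (exist _ p hp) j).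

(* The assignment of the variables in the blocks x_1..x_n, y_1..y_m, z_1..z_m
   of [xvar], [yvar], [zvar]. *)
Definition blocks (X : Type) (x0 : X) n m (a : 'I_n -> X) (b c : 'I_m -> X)
    (v : nat) : X :=
  if insub v is Some i then a i else
  if insub (v - n) is Some j then b j else
  if insub (v - n - m) is Some j then c j else x0.

Section Blocks.
Variables (X : Type) (x0 : X) (n m : nat) (a : 'I_n -> X) (b c : 'I_m -> X).

Lemma blocks_x (i : 'I_n) : blocks x0 a b c i = a i.
Proof. by rewrite /blocks valK. Qed.

Lemma blocks_y (j : 'I_m) : blocks x0 a b c (n + j) = b j.
Proof.
rewrite /blocks insubF ?addKn ?valK //.
by apply/negbTE; rewrite -leqNgt leq_addr.
Qed.

Lemma blocks_z (j : 'I_m) : blocks x0 a b c (n + m + j) = c j.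
Proof.
rewrite /blocks insubF; last by apply/negbTE; rewrite -leqNgt -addnA leq_addr.
rewrite -addnA addKn insubF; last by apply/negbTE; rewrite -leqNgt leq_addr.
by rewrite addKn valK.
Qed.

End Blocks.

Section Quotient.
Variables (tau : signature) (V : Type) (theta : term tau V -> term tau V -> Prop).

Record congruence : Prop := Congruence {
  cong_refl : forall t, theta t t;
  cong_sym : forall s t, theta s t -> theta t s;
  cong_trans : forall s t u, theta s t -> theta t u -> theta s u;
  cong_op : forall f (a b : 'I_(arity f) -> term tau V),
    (forall i, theta (a i) (b i)) -> theta (App f a) (App f b) }.

(** The quotient is carried by canonical representatives: [epsilon] picks a member of each class,
    and the carrier consists of the terms fixed by this choice. *)
Lemma quotient_exists : inhabited (term tau V) -> congruence ->
  exists (F : algebra tau) (cls : term tau V -> F),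
  [/\ forall x, exists t, x = cls t,
      forall s t, cls s = cls t <-> theta s t
    & forall (W : Type) (s : W -> term tau V) t,
        eval (fun w => cls (s w)) t = cls (subst s t)].
Proof.
move=> [t0] [refl sym trans cop].
pose r s := epsilon (inhabits t0) (theta s).
have rP s : theta s (r s) by apply: epsilon_spec; exists s.
(* Equivalent terms have extensionally equal class predicates, so [epsilon] returns the same
   representative for both. *)
have rE s t : theta s t -> r s = r t.
  move=> h; rewrite /r; congr epsilon; apply: functional_extensionality => u.
  apply: propositional_extensionality; split=> hu; last exact: trans hu.
  exact: trans (sym _ _ h) hu.
have rr s : r (r s) = r s by apply/rE/sym.
pose C := {x | r x = x}.
pose cls s : C := exist _ (r s) (rr s).
have clsE s t : theta s t -> cls s = cls t.
  by move=> h; apply: subset_eq_compat; apply: rE.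
have clsK (x : C) : x = cls (sval x).
  by case: x => x hx; apply: subset_eq_compat.
pose F := @Algebra tau C (inhabits (cls t0))
  (fun f args => cls (App f (fun i => sval (args i)))).
exists F, cls; split.
- by move=> x; exists (sval x).
- move=> s t; split; last exact: clsE.
  move=> [h]; apply: trans (rP s) _; rewrite h; exact: sym.
- move=> W s; elim=> [//|f args IH] /=; apply: clsE; apply: cop => i.
  by rewrite IH /=; apply: sym.
Qed.

Definition closed_under_qi (q : quasi_identity tau) : Prop :=
  forall s : nat -> term tau V,
    (forall e, List.In e (premises q) -> theta (subst s e.1) (subst s e.2)) ->
    theta (subst s (conclusion q).1) (subst s (conclusion q).2).

(** Choosing representatives lifts an assignment into the quotient to a substitution [s], so
    validity of a quasi-identity becomes a closure property of [theta]. *)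
Lemma quotient_in_Mod (Gam : quasi_identity tau -> Prop) :
  inhabited (term tau V) -> congruence ->
  (forall q, Gam q -> closed_under_qi q) ->
  exists (F : algebra tau) (cls : term tau V -> F),
  [/\ Mod Gam F,
      forall x, exists t, x = cls t,
      forall s t, cls s = cls t <-> theta s t
    & forall (W : Type) (s : W -> term tau V) t,
        eval (fun w => cls (s w)) t = cls (subst s t)].
Proof.
move=> ne hc hG; have [F [cls [surj clsE evalE]]] := quotient_exists ne hc.
exists F, cls; split=> // q hq rho.
pose s v := sval (constructive_indefinite_description _ (surj (rho v))).
have -> : rho = fun v => cls (s v).
  apply: functional_extensionality => v.
  exact: svalP (constructive_indefinite_description _ (surj (rho v))).
move=> hp; rewrite /holds !evalE; apply/clsE/hG => // e /hp.
by rewrite /holds !evalE => /clsE.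
Qed.

End Quotient.

(** The congruence consists of the identities valid throughout [Mod Gam]. It is closed under the
    quasi-identities of [Gam] because each of them can be applied in every algebra under every
    assignment. *)
Lemma free_algebra_exists tau (V : Type) (Gam : quasi_identity tau -> Prop) :
  inhabited (term tau V) ->
  exists (F : algebra tau) (cls : term tau V -> F),
  [/\ Mod Gam F,
      forall x, exists t, x = cls t,
      forall s t, cls s = cls t ->
        forall A, Mod Gam A -> forall rho : V -> A, eval rho s = eval rho t
    & forall (W : Type) (s : W -> term tau V) t,
        eval (fun w => cls (s w)) t = cls (subst s t)].
Proof.
move=> ne.
pose theta (s t : term tau V) :=
  forall A, Mod Gam A -> forall rho : V -> A, eval rho s = eval rho t.
have hc : congruence theta.
  split=> [//|s t h A hA rho|s t u h h' A hA rho|f a b h A hA rho].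
  - by rewrite h.
  - by rewrite h ?h'.
  - by rewrite /=; congr op; apply: functional_extensionality => i; apply: h.
have [q hq s hp A hA rho|F [cls [hF surj clsE evalE]]] :=
    quotient_in_Mod (Gam := Gam) ne hc.
  rewrite !eval_subst; apply: (hA q hq) => e /hp /(_ A hA rho).
  by rewrite !eval_subst.
by exists F, cls; split=> // s t /clsE.
Qed.

(** * The quasivariety Q^Sigma *)

Lemma holds_subst_eq tau (A : algebra tau) (V W : Type) (rho : W -> A)
    (s : V -> term tau W) (e : equation tau V) :
  holds rho (subst_eq s e) <-> holds (fun v => eval rho (s v)) e.
Proof. by rewrite /holds !eval_subst. Qed.

Lemma holds_translate_eq tau1 tau2 (T : translation tau1 tau2)
    (A : algebra tau2) (V : Type) (rho : V -> A) (e : equation tau1 V) :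
  holds rho (translate_eq T e) <-> @holds _ (pull T A) V rho e.
Proof. by rewrite /holds !eval_translate. Qed.

Lemma satisfies_translate_qi tau1 tau2 (T : translation tau1 tau2)
    (A : algebra tau2) (q : quasi_identity tau1) :
  satisfies_qi A (translate_qi T q) <-> satisfies_qi (pull T A) q.
Proof.
split=> h rho hp.
  apply/holds_translate_eq/h => _ /List.in_map_iff[e [<- /hp he]].
  exact/holds_translate_eq.
apply/holds_translate_eq/h => e he; apply/holds_translate_eq/hp.
exact: List.in_map.
Qed.

Lemma eval_to_xy tau (A : algebra tau) n m (rho : nat -> A) :
  (fun v => eval rho (@to_xy tau n m v))
    = valuation (fun i : 'I_n => rho i) (fun j : 'I_m => rho (n + j)).
Proof. by apply: functional_extensionality; case. Qed.

Lemma eval_to_xz tau (A : algebra tau) n m (rho : nat -> A) :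
  (fun v => eval rho (@to_xz tau n m v))
    = valuation (fun i : 'I_n => rho i) (fun j : 'I_m => rho (n + m + j)).
Proof. by apply: functional_extensionality; case. Qed.

(** Three tuples are assembled into one assignment by [blocks]; conversely an assignment is cut into
    its three blocks of variables. *)
Lemma satisfies_uniqueness tau (A : algebra tau) (p : efd tau) :
  (forall j, satisfies_qi A (@uniqueness tau p j)) <-> has_unique_solutions A p.
Proof.
split=> [h a b c hb hc|h j rho hp].
  have [x0] := carrier_nonempty A.
  pose rho := blocks x0 a b c.
  have rx : (fun i => rho (nat_of_ord i)) = a.
    by apply: functional_extensionality => i; apply: blocks_x.
  have ry : (fun j => rho (efd_n p + nat_of_ord j)) = b.
    by apply: functional_extensionality => j; apply: blocks_y.
  have rz : (fun j => rho (efd_n p + efd_m p + nat_of_ord j)) = c.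
    by apply: functional_extensionality => j; apply: blocks_z.
  apply: functional_extensionality => j.
  rewrite -ry -rz; apply: (h j rho) => _ /List.in_app_iff[]/List.in_map_iff[e [<- he]].
    by apply/holds_subst_eq; rewrite eval_to_xy rx ry; apply: hb.
  by apply/holds_subst_eq; rewrite eval_to_xz rx rz; apply: hc.
suff /(f_equal (fun f => f j)) : (fun k : 'I_(efd_m p) => rho (efd_n p + k))
    = fun k => rho (efd_n p + efd_m p + k) by [].
apply: (h (fun i => rho i)) => e he.
  rewrite -eval_to_xy; apply/holds_subst_eq/hp/List.in_app_iff; left.
  exact: List.in_map.
rewrite -eval_to_xz; apply/holds_subst_eq/hp/List.in_app_iff; right.
exact: List.in_map.
Qed.

(** Both sides are read as equations between terms evaluated in [A], where the translation leaves
    tau-terms alone. This avoids transporting [a] and [b] along the equality of the reducts. *)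
Lemma satisfies_eqs_reduct_pull tau nu1 nu2
    (T : translation (expand tau nu1) (expand tau nu2))
    (A : algebra (expand tau nu2)) (p : efd tau) (a : 'I_(efd_n p) -> A) b :
  tau_translation T ->
  @satisfies_eqs _ (reduct A) p a b -> @satisfies_eqs _ (reduct (pull T A)) p a b.
Proof.
move=> hT h e /h he; apply/(holds_translate_eq (@inclusion tau nu1)).
apply/(holds_translate_eq T).
move/(holds_translate_eq (@inclusion tau nu2)): he.
by rewrite /holds /= !translate_inclusion.
Qed.

(** * Members of Q^Sigma as expansions of models of Sigma *)

Section Expansion.
Variables (tau : signature) (G : quasi_identity tau -> Prop).
Variable (Sig : efd tau -> Prop).
Implicit Type B : algebra (efd_lang Sig).

(** Names the axioms whose models are, by conversion, [quasivariety_by_efds G Sig], so that the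
    quotient constructions can be applied to them. *)
Definition efd_axioms (q : quasi_identity (efd_lang Sig)) : Prop :=
  [\/ image (translate_qi (@inclusion tau _)) G q,
      E_set q
    | image (translate_qi (@inclusion tau _)) (U_set Sig) q].

Lemma eval_to_skolem B p (hp : Sig p) (rho : nat -> B) :
  (fun v => eval rho (to_skolem hp v))
    = valuation (fun i : 'I_(efd_n p) => rho i)
        (fun j => op (f := skolem hp j) (fun i => rho i)).
Proof. by apply: functional_extensionality; case. Qed.

Lemma quasivariety_by_efdsP B :
  quasivariety_by_efds G Sig B <->
  [/\ Mod G (reduct B),
      forall p (hp : Sig p) (a : 'I_(efd_n p) -> B),
        @satisfies_eqs _ (reduct B) p a (fun j => op (f := skolem hp j) a)
    & forall p, Sig p -> has_unique_solutions (reduct B) p].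
Proof.
split=> [hB|[hG hE hU] q].
  split.
  - move=> q hq; apply/satisfies_translate_qi/hB.
    by constructor 1; exists q.
  - move=> p hp a e he.
    have [x0] := carrier_nonempty B.
    (* Only the block of x-variables is read; the other two blocks repeat [a] as a filler. *)
    pose rho := blocks x0 a a a.
    have rx : (fun i => rho (nat_of_ord i)) = a.
      by apply: functional_extensionality => i; apply: blocks_x.
    have hq : satisfies_qi B (QuasiIdentity [::]
        (subst_eq (to_skolem hp) (translate_eq (@inclusion tau _) e))).
      by apply: hB; constructor 2; exists p, hp, e.
    have /holds_subst_eq/holds_translate_eq := hq rho (fun _ => False_ind _).
    by rewrite eval_to_skolem rx.
  - move=> p hp; apply/satisfies_uniqueness => j.
    apply/satisfies_translate_qi/hB; constructor 3.
    by exists (uniqueness j) => //; exists p, j.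
case=> [[q' hq' ->]|[p [hp [e he ->]]] rho _|[q' [p [j [hp ->]]] ->]].
- exact/satisfies_translate_qi/hG.
- apply/holds_subst_eq/holds_translate_eq; rewrite eval_to_skolem.
  exact: hE.
- by apply/satisfies_translate_qi; move: j; apply/satisfies_uniqueness/hU.
Qed.

Lemma reduct_Mod B : quasivariety_by_efds G Sig B ->
  Mod G (reduct B) /\ Mod_efd Sig (reduct B).
Proof.
move=> /quasivariety_by_efdsP[hG hE hU]; split=> // p hp a.
exists (fun j => op (f := skolem hp j) a); split; first exact: hE.
by move=> b hb; apply: (hU p hp a) => //; apply: hE.
Qed.

Lemma expansion_exists (A : algebra tau) : Mod G A -> Mod_efd Sig A ->
  exists2 B, quasivariety_by_efds G Sig B & reduct B = A.
Proof.
move=> hG hS.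
pose sol p hp a :=
  constructive_indefinite_description _ (hS p hp a).
(* Once [A] is destructed, the reduct of the expansion is convertible to it. *)
case: A hG hS @sol => c ne o hG hS sol.
pose oB (f : sym (efd_lang Sig)) : ('I_(arity f) -> c) -> c :=
  match f with
  | inl g => @o g
  | inr h => match h with existT (exist p hp) j => fun a => sval (sol p hp a) j end
  end.
exists (@Algebra (efd_lang Sig) c ne oB) => //.
apply/quasivariety_by_efdsP; split=> [//|p hp a e he|p hp a b b' hb hb'].
  exact: (proj1 (svalP (sol p hp a)) e he).
by have [u [_ hu]] := hS p hp a; rewrite -(hu b hb) -(hu b' hb').
Qed.

(* The new symbols name the unique solutions, so they are determined by the
   reduct. *)
Lemma expansion_unique (c : Type) (ne : inhabited c)
    (o1 o2 : forall f : sym (efd_lang Sig), ('I_(arity f) -> c) -> c) :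
  quasivariety_by_efds G Sig (Algebra ne o1) ->
  quasivariety_by_efds G Sig (Algebra ne o2) ->
  reduct (Algebra ne o1) = reduct (Algebra ne o2) :> algebra tau ->
  Algebra ne o1 = Algebra ne o2.
Proof.
move=> /quasivariety_by_efdsP[_ hE1 _] /quasivariety_by_efdsP[_ hE2 hU] hr.
apply: algebra_ext => [[g|[[p hp] j]] args].
  by have := f_equal (fun o => o g args) (algebra_inj hr).
have E1 : @satisfies_eqs _ (reduct (Algebra ne o2)) p args
    (fun j => o1 (skolem hp j) args).
  (* Stated for arbitrary operations, so that the equality of the tau-operations can be
     substituted. *)
  suff hext r1 r2 b : r1 = r2 -> @satisfies_eqs _ (Algebra ne r1) p args b ->
      @satisfies_eqs _ (Algebra ne r2) p args b.
    exact: (hext _ _ _ (algebra_inj hr) (hE1 p hp args)).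
  by move=> ->.
have := hU p hp _ _ _ E1 (hE2 p hp args).
by move/(f_equal (fun f => f j)).
Qed.

End Expansion.

(** * Interpretations between quasivarieties Q^Sigma *)

Section Interpretations.
Variables (tau : signature) (G : quasi_identity tau -> Prop).
Variables (Sig Sig' : efd tau -> Prop).
Local Notation QS := (quasivariety_by_efds G Sig).
Local Notation QS' := (quasivariety_by_efds G Sig').

Lemma interpretation_Mod T (A : algebra tau) :
  tau_interpretation QS' QS T -> Mod G A /\ Mod_efd Sig A ->
  Mod G A /\ Mod_efd Sig' A.
Proof.
move=> [hT hI] [hG hS]; have [B hB <-] := expansion_exists hG hS.
by rewrite -(reduct_pull B hT); apply/reduct_Mod/hI.
Qed.

(* The terms represent the solutions at the generators of the algebra of [QS]
   freely generated by x_1..x_n. *)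
Lemma solution_terms_exist p :
  (forall A, Mod G A /\ Mod_efd Sig A -> Mod G A /\ Mod_efd Sig' A) ->
  Sig' p -> inhabited (term (efd_lang Sig) 'I_(efd_n p)) ->
  exists t : 'I_(efd_m p) -> term (efd_lang Sig) 'I_(efd_n p),
    forall A, QS A -> forall a : 'I_(efd_n p) -> A,
      @satisfies_eqs _ (reduct A) p a (fun j => eval a (t j)).
Proof.
move=> hM hp ne; have [F [cls [hF surj clsE evalE]]] :=
  free_algebra_exists (efd_axioms G (Sig:=Sig)) ne.
(* The reduct of the free algebra is a model of [Sig], hence of [Sig']. So [p] has a solution at the
   generators, and its components are classes of terms. *)
have [_ hS'] := hM _ (reduct_Mod hF).
have [b [hb _]] := hS' p hp (fun i => cls (Var i)).
pose t j := sval (constructive_indefinite_description _ (surj (b j))).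
have tE : b = fun j => cls (t j).
  apply: functional_extensionality => j.
  exact: svalP (constructive_indefinite_description _ (surj (b j))).
exists t => A hA a e he.
have := hb e he.
have -> : valuation (fun i => cls (Var i)) b
    = fun v => cls (valuation (fun i => Var i) t v).
  by rewrite tE; apply: functional_extensionality; case.
(* Equality of two classes means an identity valid in all of [QS], which can then be evaluated at
   [a] in any [A]. *)
move/holds_translate_eq; rewrite /holds !evalE => /clsE/(_ A hA a).
rewrite !eval_subst.
have -> : (fun v => eval a (valuation (fun i => Var i) t v))
    = valuation a (fun j => eval a (t j)).
  by apply: functional_extensionality; case.
by move=> h; apply/holds_translate_eq.
Qed.

Lemma interpretation_exists :
  (has_constant (efd_lang Sig') -> has_constant (efd_lang Sig)) ->
  (forall A, Mod G A /\ Mod_efd Sig A -> Mod G A /\ Mod_efd Sig' A) ->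
  exists T, tau_interpretation QS' QS T.
Proof.
move=> hc hM.
have ne p : Sig' p -> inhabited (term (efd_lang Sig) 'I_(efd_n p)).
  (* For n > 0 a variable is a term. For n = 0 the first new symbol of [p] is a constant, so the
     language of [Sig] has a constant too. *)
  move=> hp; case En: (efd_n p) => [|n]; last by constructor; apply: Var ord0.
  case: hc => [|c hc].
    by exists (skolem hp (Ordinal (efd_m_gt0 p))).
  by constructor; apply: (@App _ _ c); rewrite hc; apply: Var.
pose t p hp := constructive_indefinite_description _
  (solution_terms_exist hM hp (ne p hp)).
pose T : translation (efd_lang Sig') (efd_lang Sig) := fun f =>
  match f with
  | inl g => @App (efd_lang Sig) _ (inl g) Var
  | inr h => match h with existT (exist p hp) j => sval (t p hp) j end
  end.
exists T; split=> [//|A hA]; apply/quasivariety_by_efdsP.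
have [hG hS'] := hM _ (reduct_Mod hA).
have hT : tau_translation T by [].
split=> [|p hp a|p hp]; rewrite ?(reduct_pull A hT) //.
  exact: (satisfies_eqs_reduct_pull hT (svalP (t p hp) A hA a)).
move=> a b c hb hc'; by have [u [_ hu]] := hS' p hp a; rewrite -(hu b hb) -(hu c hc').
Qed.

End Interpretations.

(** Both algebras lie in the quasivariety of [Sig'] and have the same reduct to tau, which
    determines the expansion. *)
Lemma interpretation_inverse tau (G : quasi_identity tau -> Prop)
    (Sig Sig' : efd tau -> Prop) T S :
  tau_interpretation (quasivariety_by_efds G Sig') (quasivariety_by_efds G Sig) T ->
  tau_interpretation (quasivariety_by_efds G Sig) (quasivariety_by_efds G Sig') S ->
  forall A, quasivariety_by_efds G Sig' A -> pull T (pull S A) = A.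
Proof.
move=> [hT hTI] [hS hSI] A hA.
have hTS := hTI _ (hSI _ hA).
have hr : reduct (pull T (pull S A)) = reduct A :> algebra tau.
  by rewrite !reduct_pull.
case: A hA hTS hr => c ne o hA hTS hr.
exact: (expansion_unique hTS hA hr).
Qed.

(** * The logic L^Sigma *)

Lemma list_in_image (X Y : Type) (g : X -> Y) (P : X -> Prop) (l : seq Y) :
  (forall y, List.In y l -> image g P y) ->
  exists2 k : seq X, forall x, List.In x k -> P x & map g k = l.
Proof.
elim: l => [|y l IH] h; first by exists [::].
have [k kP kE] := IH (fun z hz => h z (or_intror hz)).
have [x hx yE] := h y (or_introl erefl).
by exists (x :: k) => [z [<-|/kP]|/=]; rewrite ?kE -?yE.
Qed.

(** [preserves T L M] says exactly that [L] is contained in this logic, so leastness of [L] can be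
    used to show that [T] is a morphism. *)
Definition preimage_logic tau1 tau2 (T : translation tau1 tau2)
    (M : entailment tau2) : entailment tau1 :=
  fun Gam phi => M (image (translate T (V:=nat)) Gam) (translate T phi).

Lemma preimage_logic_is_logic tau1 tau2 (T : translation tau1 tau2)
    (M : entailment tau2) :
  is_logic M -> is_logic (preimage_logic T M).
Proof.
move=> hM; split; rewrite /preimage_logic.
- by move=> Gam phi h; apply: (logic_refl hM); exists phi.
- move=> Gam Gam' phi sub; apply: (logic_mono hM) => _ [psi /sub h ->].
  by exists psi.
- move=> Gam Gam' phi sub; apply: (logic_cut hM) => _ [psi /sub h ->] //.
- move=> s Gam phi /(logic_structural hM (fun v => translate T (s v))).
  rewrite -translate_subst; apply: (logic_mono hM) => _ [_ [psi h ->] ->].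
  by exists (subst s psi); [exists psi | rewrite translate_subst].
- move=> Gam phi /(logic_finitary hM)[l [lG h]].
  have [k kG kE] := list_in_image lG; exists k; split=> //.
  apply: (logic_mono hM) h => psi; rewrite -kE => /List.in_map_iff[chi [<- hc]].
  by exists chi.
Qed.

Lemma In_efd_formulas tau (Delta : seq (term tau bool)) (p : efd tau) phi :
  List.In phi (efd_formulas Delta p) <->
  exists e d, [/\ List.In e (efd_eqs p), List.In d Delta
    & phi = equiv_at e.1 e.2 d].
Proof.
rewrite /efd_formulas; elim: (efd_eqs p) => [|e l IH] /=.
  by split=> // [[e [d []]]].
rewrite List.in_app_iff IH List.in_map_iff.
split=> [[[d [<- hd]]|[e' [d [he hd ->]]]]|[e' [d [[<-|he] hd ->]]]].
- by exists e, d; split=> //; left.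
- by exists e', d; split=> //; right.
- by left; exists d.
- by right; exists e', d.
Qed.

(** The solutions of the defining equations serve as the designated elements of the algebra. *)
Definition truth tau (E : equation tau unit -> Prop) (A : algebra tau) (a : A) :
  Prop := forall e, E e -> holds (fun _ : unit => a) e.

Definition semantic_consequence tau nu (E : equation tau unit -> Prop)
    (K : algebra (expand tau nu) -> Prop) : entailment (expand tau nu) :=
  fun Gam phi => forall A, K A -> forall rho : nat -> A,
    (forall psi, Gam psi -> @truth tau E (reduct A) (eval rho psi)) ->
    @truth tau E (reduct A) (eval rho phi).

(** For an arbitrary class [K] the semantic consequence need not be finitary, hence the passage to
    the finitary part. *)
Lemma finitary_part_semantic_is_logic tau nu (E : equation tau unit -> Prop)
    (K : algebra (expand tau nu) -> Prop) :
  is_logic (finitary_part (semantic_consequence E K)).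
Proof.
split.
- move=> Gam phi h; exists [:: phi]; split=> [psi [<-|[]] //|A hA rho].
  by apply; left.
- by move=> Gam Gam' phi sub [l [lG h]]; exists l; split=> // psi /lG /sub.
- move=> Gam Gam' phi hG [l [lG h]].
  (* Cut needs one finite set of premises: the finite supports of the members of [l] are
     concatenated. *)
  have [k [kG hk]] : exists k : seq (formula (expand tau nu)),
      (forall psi, List.In psi k -> Gam psi) /\
      (forall psi, List.In psi l ->
         semantic_consequence E K (fun chi => List.In chi k) psi).
    elim: l lG {h} => [|chi l IH] lG; first by exists [::].
    have [k [kG hk]] := IH (fun psi h => lG psi (or_intror h)).
    have [k' [k'G hk']] := hG chi (lG chi (or_introl erefl)).
    exists (k' ++ k); split=> [psi /List.in_app_iff[/k'G|/kG] //|psi].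
    case=> [<-|/hk h] A hA rho hr; [apply: hk' => // | apply: h => //];
      move=> x hx; apply: hr; apply/List.in_app_iff; by [left | right].
  exists k; split=> // A hA rho hr.
  by apply: h => // psi /hk; apply.
- move=> s Gam phi [l [lG h]]; exists (map (subst s) l); split.
    by move=> _ /List.in_map_iff[psi [<- /lG hp]]; exists psi.
  move=> A hA rho hr; rewrite eval_subst; apply: h => // psi hp.
  by rewrite -eval_subst; apply: hr; apply: List.in_map.
- move=> Gam phi [l [lG h]]; exists l; split=> //.
  by exists l; split.
Qed.

(** * Equality and derivability in an algebraizable logic *)

Section Algebraizable.
Variables (tau : signature) (L : entailment tau) (G : quasi_identity tau -> Prop).
Variables (E : equation tau unit -> Prop) (Delta : seq (term tau bool)).
Hypothesis hL : is_logic L.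
Hypothesis hQ : finitely_algebraizable L (Mod G) E Delta.

Lemma algebraizable_truth Gam phi :
  L Gam phi <-> forall A, Mod G A -> forall rho : nat -> A,
    (forall psi, Gam psi -> truth E (eval rho psi)) -> truth E (eval rho phi).
Proof.
rewrite (alg_complete hQ); split=> h.
  move=> A hA rho hr e he; apply/(holds_subst_eq rho (fun _ => phi))/h => //.
  by move=> _ [psi [d hd [hp ->]]]; apply/holds_subst_eq/hr.
move=> e he A hA rho hr; apply/holds_subst_eq/h => // psi hp d hd.
by apply/(holds_subst_eq rho (fun _ => psi))/hr; exists psi, d.
Qed.

Definition delta (A : algebra tau) (a b : A) (d : term tau bool) : A :=
  eval (fun x : bool => if x then b else a) d.

Lemma eval_equiv_at (A : algebra tau) (V : Type) (rho : V -> A) s t d :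
  eval rho (equiv_at s t d) = delta (eval rho s) (eval rho t) d.
Proof.
rewrite eval_subst; congr eval.
by apply: functional_extensionality; case.
Qed.

(** The two clauses on [Delta], stated for two variables, are evaluated at [a] and [b]. Through this
    lemma equality is expressed by truth of formulas. *)
Lemma truth_delta (A : algebra tau) (a b : A) : Mod G A ->
  (forall d, List.In d Delta -> truth E (delta a b d)) <-> a = b.
Proof.
move=> hA; pose rho (v : nat) := if v is 0 then a else b.
split=> [h|<- d hd e he].
  apply: (alg_equiv_elim hQ hA (rho := rho)) => _ [d [e he [hd ->]]].
  by apply/holds_subst_eq; rewrite eval_equiv_at; apply: h.
have /holds_subst_eq : holds (fun _ => a) (defeq_at (equiv_at (Var 0) (Var 1) d) e).
  by apply: (alg_equiv_intro hQ hd he hA) => _ ->.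
by rewrite eval_equiv_at.
Qed.

Section Expansion.
Variables (nu : signature).
Local Notation incl := (translate (@inclusion tau nu)).

Lemma eval_equiv_inclusion (B : algebra (expand tau nu)) (V : Type)
    (rho : V -> B) s t d :
  eval rho (equiv_at s t (incl d))
    = @delta (reduct B) (eval rho s) (eval rho t) d.
Proof.
rewrite eval_subst eval_translate; congr (@eval tau (reduct B) bool _ d).
by apply: functional_extensionality; case.
Qed.

Variable M : entailment (expand tau nu).
Hypothesis hM : is_logic M.
Hypothesis hLM : preserves (@inclusion tau nu) L M.

(** For fixed [Gam] this is the relation whose quotient is the Lindenbaum algebra. *)
Definition equivalent (Gam : formula (expand tau nu) -> Prop)
    (s t : formula (expand tau nu)) : Prop :=
  forall d, List.In d Delta -> M Gam (equiv_at s t (incl d)).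

Definition equivalent_at (V : Type) (s : V -> formula (expand tau nu)) Gam
    (e : equation tau V) : Prop :=
  equivalent Gam (subst s (incl e.1)) (subst s (incl e.2)).

Lemma derivable_transfer Gam0 phi0 Gam (s : nat -> formula (expand tau nu)) :
  L Gam0 phi0 -> (forall psi, Gam0 psi -> M Gam (subst s (incl psi))) ->
  M Gam (subst s (incl phi0)).
Proof.
move=> /hLM/(logic_structural hM s) h h0; apply: (logic_cut hM) h.
by move=> _ [_ [psi hp ->] ->]; apply: h0.
Qed.

(** By [truth_delta] and algebraizability, an equational consequence of Q is an entailment of [L]
    between the corresponding [Delta]-formulas, and [M] inherits it. The congruence properties for
    tau are instances. *)
Lemma equivalent_transfer Th e Gam (s : nat -> formula (expand tau nu)) :
  eq_conseq (Mod G) Th e -> (forall e', Th e' -> equivalent_at s Gam e') ->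
  equivalent_at s Gam e.
Proof.
move=> hc hT d hd.
have := @derivable_transfer (fun phi => exists e' d', [/\ Th e', List.In d' Delta
  & phi = equiv_at e'.1 e'.2 d']) (equiv_at e.1 e.2 d) Gam s.
rewrite translate_equiv_at subst_equiv_at; apply.
  apply/algebraizable_truth => A hA rho hr; rewrite eval_equiv_at.
  apply: (proj2 (truth_delta _ _ hA) _ d hd); apply: hc => // e' he'.
  apply/truth_delta => // d' hd'; rewrite -eval_equiv_at.
  by apply: hr; exists e', d'.
move=> _ [e' [d' [he' hd' ->]]].
by rewrite translate_equiv_at subst_equiv_at; apply: hT.
Qed.

Lemma equivalent_refl Gam t : equivalent Gam t t.
Proof.
by apply: (@equivalent_transfer (fun _ => False) (Var 0, Var 0) _ (fun _ => t)).
Qed.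

Lemma equivalent_sym Gam s t : equivalent Gam s t -> equivalent Gam t s.
Proof.
move=> h; apply: (@equivalent_transfer (fun e => e = (Var 0, Var 1))
  (Var 1, Var 0) _ (fun v => if v is 0 then s else t)) => [A _ rho|_ -> //].
by move/(_ _ erefl).
Qed.

Lemma equivalent_trans Gam s t u :
  equivalent Gam s t -> equivalent Gam t u -> equivalent Gam s u.
Proof.
move=> h h'; apply: (@equivalent_transfer
  (fun e => e = (Var 0, Var 1) \/ e = (Var 1, Var 2)) (Var 0, Var 2) _
  (fun v => if v is v'.+1 then if v' is 0 then t else u else s)).
  move=> A _ rho hr; have := hr _ (or_introl erefl).
  by rewrite /holds /= => ->; apply: hr (or_intror erefl).
by move=> _ [->|->].
Qed.

Lemma equivalent_op Gam (f : sym tau)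
    (a b : 'I_(arity f) -> formula (expand tau nu)) :
  (forall i, equivalent Gam (a i) (b i)) ->
  equivalent Gam (@App (expand tau nu) _ (inl f) a)
    (@App (expand tau nu) _ (inl f) b).
Proof.
move=> h; pose k := arity f.
(* The x-block is empty, so with k the arity of [f] the tuples [a] and [b] occupy the variables
   0..k-1 and k..2k-1. *)
pose s := blocks (Var 0) (fun i : 'I_0 => Var (i : nat)) a b.
have sa (i : 'I_k) : s (0 + i) = a i by apply: blocks_y.
have sb (i : 'I_k) : s (0 + k + i) = b i by apply: blocks_z.
have := @equivalent_transfer
  (fun e => exists i : 'I_k, e = (Var (0 + i), Var (0 + k + i)))
  (App f (fun i => Var (0 + i)), App f (fun i => Var (0 + k + i))) Gam s.
rewrite /equivalent_at /= (functional_extensionality _ _ sa).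
rewrite (functional_extensionality _ _ sb); apply.
  move=> A _ rho hr; congr op; apply: functional_extensionality => i.
  exact: (hr _ (ex_intro _ i erefl)).
by move=> _ [i ->] /=; rewrite sa sb.
Qed.

(** Restricted to tau-terms: compatibility with the new symbols is derived from this lemma later. *)
Lemma equivalent_subst (V : Type) Gam (s r : V -> formula (expand tau nu))
    (t : term tau V) :
  (forall v, equivalent Gam (s v) (r v)) ->
  equivalent Gam (subst s (incl t)) (subst r (incl t)).
Proof.
move=> h; elim: t => [v|f args IH] /=; first exact: h.
exact: equivalent_op.
Qed.

(** In [L] the formulas x and [Delta](x, y) entail y, because truth of [Delta](x, y) makes the
    values of x and y equal. *)
Lemma equivalent_mp Gam s t : equivalent Gam s t -> M Gam s -> M Gam t.
Proof.
move=> h hs; apply: (@derivable_transfer (fun phi => phi = Var 0 \/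
  exists2 d, List.In d Delta & phi = equiv_at (Var 0) (Var 1) d) (Var 1) Gam
  (fun v => if v is 0 then s else t)).
  apply/algebraizable_truth => A hA rho hr /=.
  have <- : rho 0 = rho 1.
    apply/truth_delta => // d hd.
    have := hr (equiv_at (Var 0) (Var 1) d).
    by rewrite eval_equiv_at; apply; right; exists d.
  by apply: (hr (Var 0)); left.
move=> _ [->//|[d hd ->]].
by rewrite translate_equiv_at subst_equiv_at; apply: h.
Qed.

Lemma equivalent_structural Gam Gam' s t (r : nat -> formula (expand tau nu)) :
  (forall psi, Gam psi -> M Gam' (subst r psi)) ->
  equivalent Gam s t -> equivalent Gam' (subst r s) (subst r t).
Proof.
move=> sub h d /h /(logic_structural hM r); rewrite subst_equiv_at.
by apply: (logic_cut hM) => _ [psi /sub hp ->].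
Qed.

End Expansion.

(** * Axioms and soundness of L^Sigma *)

Section EFD.
Variable Sig : efd tau -> Prop.
Local Notation Lam := (efd_lang Sig).
Local Notation incl := (translate (@inclusion tau (skolem_sig Sig))).
Local Notation QS := (quasivariety_by_efds G Sig).

(** The conditions of [realizes_efds] restated through [equivalent], without the intermediate logics
    L^Phi and with uniqueness as a rule for arbitrary premises. *)
Record efd_logic (M : entailment Lam) : Prop := EfdLogic {
  el_contains : preserves (@inclusion tau _) L M;
  el_existence : forall p (hp : Sig p) e, List.In e (efd_eqs p) ->
    equivalent_at M (to_skolem hp) (fun _ => False) e;
  el_uniqueness : forall p, Sig p -> forall Gam,
    (forall e, List.In e (efd_eqs p) ->
       equivalent M Gam (incl (subst (@to_xy _ _ _) e.1))
         (incl (subst (@to_xy _ _ _) e.2))) ->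
    (forall e, List.In e (efd_eqs p) ->
       equivalent M Gam (incl (subst (@to_xz _ _ _) e.1))
         (incl (subst (@to_xz _ _ _) e.2))) ->
    forall j : 'I_(efd_m p),
      equivalent M Gam (yvar (efd_n p) j) (zvar (efd_n p) j) }.

Lemma translate_to_new_symbols p (hp : Sig p) :
  (fun v => translate (efd_inclusion hp)
     (@to_new_symbols tau (efd_n p) (efd_m p) v)) = to_skolem hp.
Proof. by apply: functional_extensionality; case. Qed.

Lemma realizes_efdsP (M : entailment Lam) : is_logic M ->
  realizes_efds L Delta Sig M <-> efd_logic M.
Proof.
move=> hM; split=> [[hLM hE]|[hLM hE hU]]; split=> //.
- move=> p hp e he d hd.
  have [_ hP _] := logic_by_formulas_least Delta (efd_formulas Delta p) hL.
  have hphi : List.In (equiv_at e.1 e.2 d) (efd_formulas Delta p).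
    by apply/In_efd_formulas; exists e, d.
  have := hE p hp _ _ (rf_existence hP hphi).
  rewrite translate_subst (@translate_inclusion _ _ _ (efd_inclusion hp)) //.
  rewrite translate_to_new_symbols.
  rewrite translate_equiv_at subst_equiv_at.
  by apply: (logic_mono hM) => _ [psi []].
- move=> p hp Gam hy hz j d hd.
  have [_ hP _] := logic_by_formulas_least Delta (efd_formulas Delta p) hL.
  have := hE p hp _ _ (rf_uniqueness hP j hd).
  rewrite (@translate_inclusion _ _ _ (efd_inclusion hp)) // translate_equiv_at.
  apply: (logic_cut hM) => _ [_ [psi hpsi ->] ->].
  rewrite (@translate_inclusion _ _ _ (efd_inclusion hp)) //.
  by case/List.in_app_iff: hpsi => /List.in_map_iff[phi [<- hphi]];
    case/In_efd_formulas: hphi => e [d' [he hd' ->]];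
    rewrite subst_equiv_at translate_equiv_at; [apply: hy|apply: hz].
(* Leastness of L^Phi is applied to the preimage of [M] along [efd_inclusion], which is shown to
   realize the formulas of [p]. *)
- move=> p hp Gam phi /(_ (preimage_logic (efd_inclusion hp) M)); apply.
    exact: preimage_logic_is_logic.
  split.
  + move=> Gam' phi' /hLM; rewrite /preimage_logic.
    rewrite (@translate_inclusion _ _ _ (efd_inclusion hp)) //.
    apply: (logic_mono hM) => _ [psi h ->]; exists (translate (@inclusion tau _) psi).
      by exists psi.
    by rewrite (@translate_inclusion _ _ _ (efd_inclusion hp)).
  + move=> _ /In_efd_formulas[e [d [he hd ->]]]; rewrite /preimage_logic.
    rewrite translate_subst (@translate_inclusion _ _ _ (efd_inclusion hp)) //.
    rewrite translate_to_new_symbols.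
    rewrite translate_equiv_at subst_equiv_at.
    by apply: (logic_mono hM) (hE p hp e he d hd).
  + move=> j d hd; rewrite /preimage_logic.
    rewrite (@translate_inclusion _ _ _ (efd_inclusion hp)) // translate_equiv_at.
    apply: (hU p hp) => // e he d' hd'; apply: (logic_refl hM).
      exists (translate (@inclusion tau _) (subst (@to_xy _ _ _) (equiv_at e.1 e.2 d'))).
        eexists; last reflexivity.
        apply/List.in_app_iff; left; apply: List.in_map.
        by apply/In_efd_formulas; exists e, d'.
      rewrite (@translate_inclusion _ _ _ (efd_inclusion hp)) //.
      by rewrite subst_equiv_at translate_equiv_at.
    exists (translate (@inclusion tau _) (subst (@to_xz _ _ _) (equiv_at e.1 e.2 d'))).
      eexists; last reflexivity.
      apply/List.in_app_iff; right; apply: List.in_map.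
      by apply/In_efd_formulas; exists e, d'.
    rewrite (@translate_inclusion _ _ _ (efd_inclusion hp)) //.
    by rewrite subst_equiv_at translate_equiv_at.
Qed.

Lemma logic_by_efds_is_logic : is_logic (logic_by_efds L Delta Sig).
Proof. by have [] := logic_by_efds_least Delta Sig hL. Qed.

Lemma logic_by_efds_efd_logic : efd_logic (logic_by_efds L Delta Sig).
Proof.
have [? ? _] := logic_by_efds_least Delta Sig hL.
exact/realizes_efdsP.
Qed.

Lemma logic_by_efds_sub (M : entailment Lam) Gam phi :
  is_logic M -> efd_logic M -> logic_by_efds L Delta Sig Gam phi -> M Gam phi.
Proof. by move=> hM hE; apply=> //; apply/realizes_efdsP. Qed.

Lemma truth_equivalent (B : algebra Lam) (rho : nat -> B) s t :
  Mod G (reduct B) ->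
  (forall d, List.In d Delta ->
     @truth _ E (reduct B) (eval rho (equiv_at s t (incl d)))) <->
  eval rho s = eval rho t.
Proof.
move=> hB; rewrite -(truth_delta _ _ hB).
by split=> h d /h; rewrite eval_equiv_inclusion.
Qed.

Lemma logic_by_efds_sound Gam phi :
  logic_by_efds L Delta Sig Gam phi -> semantic_consequence E QS Gam phi.
Proof.
suff /logic_by_efds_sub hs : efd_logic (finitary_part (semantic_consequence E QS)).
  move=> /hs[]; first exact: finitary_part_semantic_is_logic.
  by move=> l [lG h] A hA rho hr; apply: h => // psi /lG /hr.
split.
- move=> Gam' phi' /(logic_finitary hL)[l [lG h]].
  exists (map (translate (@inclusion tau _) (V:=nat)) l); split.
    by move=> _ /List.in_map_iff[psi [<- /lG hp]]; exists psi.
  move=> A hA rho hr; rewrite eval_translate.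
  move/algebraizable_truth: h; apply; first by case: (reduct_Mod hA).
  by move=> psi hp; rewrite -eval_translate; apply/hr/List.in_map.
- move=> p hp e he d hd; exists [::]; split=> // A hA rho _.
  move: d hd; apply/truth_equivalent; first by case: (reduct_Mod hA).
  case/quasivariety_by_efdsP: hA => _ hE _.
  rewrite !eval_subst eval_to_skolem !eval_translate; exact: hE.
- move=> p hp Gam' hy hz j d hd.
  (* The finitely many formulas saying that y and z both solve the system at x. Since [Gam'] derives
     each of them, cut reduces the claim to the premises [l]. *)
  pose l := map (translate (@inclusion tau (skolem_sig Sig)) (V:=nat))
    (map (subst (@to_xy _ _ _)) (efd_formulas Delta p)
     ++ map (subst (@to_xz _ _ _)) (efd_formulas Delta p)).
  have hxy e d' : List.In e (efd_eqs p) -> List.In d' Delta -> List.In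
      (equiv_at (incl (subst (@to_xy _ _ _) e.1)) (incl (subst (@to_xy _ _ _) e.2))
         (incl d')) l.
    move=> he hd'; rewrite -translate_equiv_at -subst_equiv_at.
    apply/List.in_map/List.in_app_iff; left; apply: List.in_map.
    by apply/In_efd_formulas; exists e, d'.
  have hxz e d' : List.In e (efd_eqs p) -> List.In d' Delta -> List.In
      (equiv_at (incl (subst (@to_xz _ _ _) e.1)) (incl (subst (@to_xz _ _ _) e.2))
         (incl d')) l.
    move=> he hd'; rewrite -translate_equiv_at -subst_equiv_at.
    apply/List.in_map/List.in_app_iff; right; apply: List.in_map.
    by apply/In_efd_formulas; exists e, d'.
  apply: (logic_cut (finitary_part_semantic_is_logic _ _)
    (Gam' := fun psi => List.In psi l)).
    move=> _ /List.in_map_iff[psi [<- /List.in_app_iff hpsi]].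
    by case: hpsi => /List.in_map_iff[chi [<- hchi]];
      case/In_efd_formulas: hchi => e [d' [he hd' ->]];
      rewrite subst_equiv_at translate_equiv_at; [apply: hy|apply: hz].
  exists l; split=> // A hA rho hr.
  have [hG _ hU] := (proj1 (quasivariety_by_efdsP _ _) hA).
  move: d hd; apply/truth_equivalent => //.
  have := hU p hp (fun i => rho i) (fun j => rho (efd_n p + j))
    (fun j => rho (efd_n p + efd_m p + j)).
  (* One statement for both solutions: [r] stands for [to_xy] or [to_xz]. *)
  suff hs : forall (b : 'I_(efd_m p) -> A) r,
    (fun v => @eval _ (reduct A) _ rho (r v))
      = valuation (fun i : 'I_(efd_n p) => rho i) b ->
    (forall e d', List.In e (efd_eqs p) -> List.In d' Delta -> List.In
       (equiv_at (incl (subst r e.1)) (incl (subst r e.2)) (incl d')) l) ->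
    @satisfies_eqs _ (reduct A) p (fun i => rho i) b.
    move=> /(_ (hs _ _ (@eval_to_xy _ (reduct A) _ _ rho) hxy)).
    move=> /(_ (hs _ _ (@eval_to_xz _ (reduct A) _ _ rho) hxz)).
    by move/(f_equal (fun f => f j)).
  move=> b r rE hin e he; rewrite /holds -rE -!eval_subst.
  rewrite -!(@eval_translate _ _ _ A); apply/truth_equivalent => // d' hd'.
  by apply/hr/hin.
Qed.


(** * Completeness by Lindenbaum algebras *)

Section Completeness.
Variable M : entailment Lam.
Hypothesis hM : is_logic M.
Hypothesis hE : efd_logic M.

(** The uniqueness rule is applied to the set of all [psi] whose instance under [s] is derivable
    from [Gam]; structurality and cut then give the instance of its conclusion. *)
Lemma equivalent_unique p (hp : Sig p) Gam (s : nat -> formula Lam) :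
  (forall e, List.In e (efd_eqs p) ->
     equivalent M Gam (subst s (incl (subst (@to_xy _ _ _) e.1)))
       (subst s (incl (subst (@to_xy _ _ _) e.2)))) ->
  (forall e, List.In e (efd_eqs p) ->
     equivalent M Gam (subst s (incl (subst (@to_xz _ _ _) e.1)))
       (subst s (incl (subst (@to_xz _ _ _) e.2)))) ->
  forall j : 'I_(efd_m p),
    equivalent M Gam (s (efd_n p + j)) (s (efd_n p + efd_m p + j)).
Proof.
move=> hy hz j.
apply: (equivalent_structural hM (r := s) (Gam := fun psi => M Gam (subst s psi))
  _ (s := yvar _ j) (t := zvar _ j)) => //.
by apply: (el_uniqueness hE hp) => e he d hd; apply: (logic_refl hM);
  rewrite subst_equiv_at; [apply: hy | apply: hz].
Qed.

(** The parameters [a] are kept apart from the arguments [b] of the new symbols, so that one can be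
    replaced without the other. *)
Definition skolem_valuation p (hp : Sig p) (V : Type)
    (a b : 'I_(efd_n p) -> term Lam V) : 'I_(efd_n p) + 'I_(efd_m p) -> term Lam V :=
  valuation a (fun j => App (skolem hp j) b).

Lemma equivalent_solution p (hp : Sig p) Gam (a : 'I_(efd_n p) -> formula Lam) e :
  List.In e (efd_eqs p) -> equivalent_at M (skolem_valuation hp a a) Gam e.
Proof.
move=> he.
pose r := blocks (Var 0) a a a.
have rE t : subst r (subst (to_skolem hp) (incl t))
    = subst (skolem_valuation hp a a) (incl t).
  rewrite subst_subst; congr subst; apply: functional_extensionality => -[i|j] /=.
    exact: blocks_x.
  congr (App (skolem hp j)); apply: functional_extensionality => i; exact: blocks_x.
rewrite /equivalent_at -!rE.
by apply: (equivalent_structural hM _ (el_existence hE hp he)).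
Qed.

Lemma equivalent_skolem p (hp : Sig p) j Gam (a b : 'I_(efd_n p) -> formula Lam) :
  (forall i, equivalent M Gam (a i) (b i)) ->
  equivalent M Gam (App (skolem hp j) a) (App (skolem hp j) b).
Proof.
move=> h; pose s := blocks (Var 0) a (fun k => App (skolem hp k) a)
  (fun k => App (skolem hp k) b).
have sy t : subst s (incl (subst (@to_xy _ _ _) t))
    = subst (skolem_valuation hp a a) (incl t).
  rewrite translate_subst subst_subst; congr subst.
  apply: functional_extensionality => -[i|k] /=; first exact: blocks_x.
  exact: blocks_y.
have sz t : subst s (incl (subst (@to_xz _ _ _) t))
    = subst (skolem_valuation hp a b) (incl t).
  rewrite translate_subst subst_subst; congr subst.
  apply: functional_extensionality => -[i|k] /=; first exact: blocks_x.
  exact: blocks_z.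
have := @equivalent_unique p hp Gam s.
move=> /(_ _ _ j); rewrite /s blocks_y blocks_z -/s; apply=> e he.
  by rewrite !sy; apply: equivalent_solution.
rewrite !sz.
have hLM := el_contains hE.
(* The values of the new symbols at [b] solve the system at [b]. Replacing the parameters [b] by the
   equivalent [a] inside tau-terms shows that they also solve it at [a]. *)
have hab t : equivalent M Gam (subst (skolem_valuation hp a b) (incl t))
    (subst (skolem_valuation hp b b) (incl t)).
  apply: (equivalent_subst hM hLM) => -[i|k] /=; first exact: h.
  exact: (equivalent_refl hM hLM).
apply: (equivalent_trans hM hLM (hab _)).
apply: (equivalent_trans hM hLM _ (equivalent_sym hM hLM (hab _))).
exact: equivalent_solution.
Qed.

Lemma equivalent_congruence Gam : congruence (equivalent M Gam).
Proof.
have hLM := el_contains hE; split.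
- exact: (equivalent_refl hM hLM).
- exact: (equivalent_sym hM hLM).
- exact: (equivalent_trans hM hLM).
- move=> [f|[[p hp] j]] a b; first exact: (equivalent_op hM hLM).
  exact: (@equivalent_skolem p hp j).
Qed.

(* The Lindenbaum algebra of the theory generated by [Gam] belongs to [QS]. *)
Lemma equivalent_complete Th e Gam : eq_conseq QS Th e ->
  (forall e', Th e' -> equivalent M Gam e'.1 e'.2) -> equivalent M Gam e.1 e.2.
Proof.
move=> hc hT; have hLM := el_contains hE.
have [q hq s hs|F [cls [hF _ clsE evalE]]] :=
    quotient_in_Mod (Gam := efd_axioms G (Sig := Sig))
      (inhabits (Var 0 : formula Lam)) (equivalent_congruence Gam).
  case: hq hs => [[q' hq' ->]|[p [hp [e' he' ->]]]|[q' [p [j [hp ->]]] ->]] hs.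
  - apply: (@equivalent_transfer _ _ hM hLM (fun e => List.In e (premises q'))
      (conclusion q')) => [A hA|e' he']; first exact: hA.
    exact: (hs _ (List.in_map _ _ _ he')).
  - by apply: (equivalent_structural hM _ (el_existence hE hp he')).
  - by apply: (equivalent_unique hp) => e' he';
      apply: (hs (translate_eq _ (subst_eq _ e')));
      apply/List.in_map/List.in_app_iff; [left | right]; apply: List.in_map.
have subst_Var (t : formula Lam) : subst Var t = t.
  by elim: t => [//|f args IH] /=; congr App; apply: functional_extensionality.
have clsV (t : formula Lam) : eval (fun v => cls (Var v)) t = cls t.
  by rewrite (evalE _ Var) subst_Var.
(* The consequence is evaluated in the Lindenbaum algebra, each variable being sent to its own
   class. *)
apply/clsE; rewrite -!clsV; apply: hc => // e' /hT /clsE.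
by rewrite /holds !clsV.
Qed.

End Completeness.

End EFD.

(** * Morphisms and interpretations *)

Section Correspondence.
Variables (Sig Sig' : efd tau -> Prop).
Local Notation QS := (quasivariety_by_efds G Sig).
Local Notation QS' := (quasivariety_by_efds G Sig').
Local Notation LS := (logic_by_efds L Delta Sig).
Local Notation LS' := (logic_by_efds L Delta Sig').
Local Notation incl := (translate (@inclusion tau (skolem_sig Sig))).
Local Notation incl' := (translate (@inclusion tau (skolem_sig Sig'))).

(** By leastness it suffices that the preimage of [LS] along [T] is an [efd_logic]. The axioms of
    [QS'] translate to quasi-identities valid in [QS], and completeness makes their [Delta]-forms
    derivable in [LS]. *)
Lemma interpretation_morphism T :
  tau_interpretation QS' QS T -> tau_morphism LS' LS T.
Proof.
move=> [hT hI]; split=> // Gam phi.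
have hLS := logic_by_efds_is_logic Sig; have hES := logic_by_efds_efd_logic Sig.
have preim Gam' s t : equivalent (preimage_logic T LS) Gam' s t <->
    equivalent LS (image (translate T (V := nat)) Gam') (translate T s) (translate T t).
  by split=> h d /h; rewrite /preimage_logic translate_equiv_at translate_inclusion.
have ax q Gam' : efd_axioms G (Sig := Sig') q ->
    (forall e, List.In e (premises q) -> equivalent (preimage_logic T LS) Gam' e.1 e.2) ->
    equivalent (preimage_logic T LS) Gam' (conclusion q).1 (conclusion q).2.
  move=> hq hp; apply/preim.
  apply: (equivalent_complete hLS hES (e := translate_eq T (conclusion q))
    (Th := fun e => exists2 e', List.In e' (premises q) & e = translate_eq T e')).
    move=> A hA rho hr; apply/holds_translate_eq; apply: (hI A hA q hq) => e he.
    by apply/holds_translate_eq/hr; exists e.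
  move=> _ [e he ->]; exact: (proj1 (preim _ _ _) (hp e he)).
apply: (logic_by_efds_sub (M := preimage_logic T LS)).
  exact: preimage_logic_is_logic.
split.
- move=> Gam' phi' /(el_contains hES); rewrite /preimage_logic translate_inclusion //.
  apply: (logic_mono hLS) => _ [psi h ->]; exists (incl' psi); first by exists psi.
  by rewrite translate_inclusion.
- move=> p hp e he; apply: (ax (QuasiIdentity [::]
    (subst_eq (to_skolem hp) (translate_eq (@inclusion tau _) e)))) => //.
  by constructor 2; exists p, hp, e.
- move=> p hp Gam' hy hz j.
  apply: (ax (translate_qi (@inclusion tau _) (uniqueness j))).
    by constructor 3; exists (uniqueness j) => //; exists p, j.
  move=> _ /List.in_map_iff[e [<- /List.in_app_iff he]].
  by case: he => /List.in_map_iff[e' [<- he']]; [apply: hy | apply: hz].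
Qed.

(** The existence and uniqueness axioms of [QS'] are entailments of [LS'] between [Delta]-formulas;
    their translations hold in [LS] and are sound in [QS]. The axioms of Q persist because the
    reduct is unchanged. *)
Lemma morphism_interpretation T :
  tau_morphism LS' LS T -> tau_interpretation QS' QS T.
Proof.
move=> [hT hM]; split=> // A hA.
have hES' := logic_by_efds_efd_logic Sig'.
have [hG _] := reduct_Mod hA.
have sound Gam s t (rho : nat -> A) : equivalent LS' Gam s t ->
    (forall psi, Gam psi -> @truth _ E (reduct A) (eval rho (translate T psi))) ->
    eval rho (translate T s) = eval rho (translate T t).
  move=> h hr; apply/truth_equivalent => // d /h /hM /logic_by_efds_sound.
  rewrite translate_equiv_at translate_inclusion //; apply=> //.
  by move=> _ [psi /hr hp ->].
move=> q [[q' hq' ->]|[p [hp [e he ->]]] rho _|[q' [p [j [hp ->]]] ->] rho hr].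
- by apply/satisfies_translate_qi; rewrite reduct_pull //; apply: hG.
- apply/holds_translate_eq; apply: (sound _ _ _ rho (el_existence hES' hp he)).
  by move=> psi [].
apply/holds_translate_eq.
apply: (sound _ _ _ rho (el_uniqueness hES' hp (Gam := fun phi => exists e d,
  [/\ List.In e (premises (translate_qi (@inclusion tau (skolem_sig Sig'))
        (@uniqueness tau p j))),
      List.In d Delta & phi = equiv_at e.1 e.2 (incl' d)]) _ _ j)).
- move=> e he d hd; apply: (logic_refl (logic_by_efds_is_logic Sig')).
  exists (translate_eq (@inclusion tau _) (subst_eq (@to_xy _ _ _) e)), d; split=> //.
  by apply/List.in_map/List.in_app_iff; left; apply: List.in_map.
- move=> e he d hd; apply: (logic_refl (logic_by_efds_is_logic Sig')).
  exists (translate_eq (@inclusion tau _) (subst_eq (@to_xz _ _ _) e)), d; split=> //.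
  by apply/List.in_map/List.in_app_iff; right; apply: List.in_map.
move=> _ [e [d [he hd ->]]]; rewrite translate_equiv_at translate_inclusion //.
move: d hd; apply/truth_equivalent => //.
exact/(holds_translate_eq T)/hr.
Qed.

(** [phi] and its double translation have equal values in every algebra of [QS'], so completeness
    makes them equivalent and detachment gives interderivability. *)
Lemma pull_inverse_interderivable (T : translation (efd_lang Sig') (efd_lang Sig))
    (S : translation (efd_lang Sig) (efd_lang Sig')) :
  (forall A, QS' A -> pull T (pull S A) = A) ->
  forall phi, interderivable LS' phi (translate S (translate T phi)).
Proof.
move=> hTS phi.
have hLS := logic_by_efds_is_logic Sig'; have hES := logic_by_efds_efd_logic Sig'.
have heq Gam : equivalent LS' Gam phi (translate S (translate T phi)).
  apply: (equivalent_complete hLS hES (Th := fun _ => False)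
    (e := (phi, translate S (translate T phi)))) => // A /hTS hA rho _.
  rewrite /holds /= !eval_translate; case: A hA rho => c ne o hA rho.
  suff hext o' : o' = o ->
    @eval _ (Algebra ne o) _ rho phi = @eval _ (Algebra ne o') _ rho phi.
    exact: hext _ (algebra_inj hA).
  by move=> ->.
have hLM := el_contains hES.
split; apply: (equivalent_mp hLS hLM); [exact: heq | exact: (logic_refl hLS)| |].
  exact: (equivalent_sym hLS hLM (heq _)).
exact: (logic_refl hLS).
Qed.

(* Interderivability of [phi] and [S (T phi)] is applied to the formulas of
   Delta(f(x), y): these are sent to Delta(S (T f)(x), y), and the instance
   y = f(x) yields S (T f)(x) = f(x). *)
Lemma interderivable_pull_inverse (T : translation (efd_lang Sig') (efd_lang Sig))
    (S : translation (efd_lang Sig) (efd_lang Sig')) :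
  tau_translation T -> tau_translation S ->
  (forall phi, interderivable LS' phi (translate S (translate T phi))) ->
  forall A, QS' A -> pull T (pull S A) = A.
Proof.
move=> hT hS hTS; case=> c ne o hA; apply: algebra_ext => f args.
set A := Algebra ne o in hA *.
have [hG _] := reduct_Mod hA.
(* The arguments of [f] occupy the first variables, and the next variable, called [y] below,
   receives the value of [f] at them. *)
pose rho := blocks (o f args) args (fun _ : 'I_1 => o f args)
  (fun _ : 'I_1 => o f args) : nat -> A.
have rx : (fun i => rho (nat_of_ord i)) = args.
  by apply: functional_extensionality => i; apply: blocks_x.
pose t : formula (efd_lang Sig') := App f (fun i => Var (nat_of_ord i)).
pose y : formula (efd_lang Sig') := Var (arity f + 0).
have ty : eval rho t = eval rho y.
  rewrite /= rx; symmetry.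
  exact: (blocks_y _ _ (fun _ : 'I_1 => o f args) _ ord0).
have : eval rho (translate S (translate T t)) = eval rho y.
  apply/truth_equivalent => // d hd.
  (* At [rho] the formulas [Delta](t, y) are true, since [t] and [y] have equal values; soundness
     then makes their double translations true. *)
  have [h _] := hTS (equiv_at t y (incl' d)).
  have := logic_by_efds_sound h hA (rho := rho).
  rewrite !translate_equiv_at !translate_inclusion //; apply=> _ ->.
  by move: d hd {h}; apply/truth_equivalent.
by rewrite -ty !eval_translate /= rx => <-.
Qed.

End Correspondence.
End Algebraizable.

(** * The two groups of equivalences *)

Theorem theorem3p2
  (tau : signature) (L : entailment tau)
  (G : quasi_identity tau -> Prop)
  (E : equation tau unit -> Prop) (Delta : list (term tau bool))
  (Sig Sig' : efd tau -> Prop)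
  (hL : is_logic L)
  (hQ : finitely_algebraizable L (Mod G) E Delta) :
  let LS := logic_by_efds L Delta Sig in
  let LS' := logic_by_efds L Delta Sig' in
  let QS := quasivariety_by_efds G Sig in
  let QS' := quasivariety_by_efds G Sig' in
  (((exists T, tau_morphism LS' LS T) <->
    (exists T, tau_interpretation QS' QS T)) /\
   ((exists T, tau_interpretation QS' QS T) ->
    (forall A : algebra tau,
       Mod G A /\ Mod_efd Sig A -> Mod G A /\ Mod_efd Sig' A)) /\
   ((has_constant (efd_lang Sig') -> has_constant (efd_lang Sig)) ->
    (forall A : algebra tau,
       Mod G A /\ Mod_efd Sig A -> Mod G A /\ Mod_efd Sig' A) ->
    (exists T, tau_interpretation QS' QS T)))
  /\
  ((tau_equipollent LS' LS <-> tau_term_equivalent QS' QS) /\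
   (tau_term_equivalent QS' QS ->
    (forall A : algebra tau,
       Mod G A /\ Mod_efd Sig A <-> Mod G A /\ Mod_efd Sig' A)) /\
   ((has_constant (efd_lang Sig') <-> has_constant (efd_lang Sig)) ->
    (forall A : algebra tau,
       Mod G A /\ Mod_efd Sig A <-> Mod G A /\ Mod_efd Sig' A) ->
    tau_term_equivalent QS' QS)).
Proof.
have morphism_iff Sig1 Sig2 T :
    tau_morphism (logic_by_efds L Delta Sig1) (logic_by_efds L Delta Sig2) T <->
    tau_interpretation (quasivariety_by_efds G Sig1) (quasivariety_by_efds G Sig2) T.
  by split; [apply: (morphism_interpretation hL hQ)
            |apply: (interpretation_morphism hL hQ)].
move=> LS LS' QS QS'; split; split.
- by split=> -[T /morphism_iff hT]; exists T.
- split=> [[T hT] A|]; first exact: interpretation_Mod hT.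
  exact: interpretation_exists.
- split=> -[T [S [hT hS hTS hST]]]; exists T, S.
    have [tT _] := hT; have [tS _] := hS.
    split; [exact/morphism_iff|exact/morphism_iff|..].
      exact: (interderivable_pull_inverse hL hQ tT tS hTS).
    exact: (interderivable_pull_inverse hL hQ tS tT hST).
  split; [exact/morphism_iff|exact/morphism_iff|..].
    exact: (pull_inverse_interderivable hL hQ hTS).
  exact: (pull_inverse_interderivable hL hQ hST).
- split=> [[T [S [hT hS _ _]]] A|hc hM].
    by split; [apply: interpretation_Mod hT | apply: interpretation_Mod hS].
  have [T hT] := interpretation_exists (proj1 hc) (fun A => proj1 (hM A)).
  have [S hS] := interpretation_exists (proj2 hc) (fun A => proj2 (hM A)).
  (* The two interpretations are obtained independently of each other; uniqueness of expansions
     makes them mutually inverse. *)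
  exists T, S; split=> //.
    exact: (interpretation_inverse hT hS).
  exact: (interpretation_inverse hS hT).
Qed.
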